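(* Let $F_1$ be a reproducing kernel Hilbert space of real-valued functions on a set $D_1$. Assume that there are functions $e_1,e_2:D_1\to\mathbb R$ such that $e_1^2$, $e_2^2$ and $\sqrt2\,e_1e_2$ belong to $F_1$ and are orthonormal in $F_1$, and let $S_1$ be a continuous linear functional on $F_1$ with $S_1(e_1^2)=S_1(e_2^2)=\sqrt2/2$ and $S_1(e_1e_2)=0$. Then for all $d,n\in\mathbb N$ the tensor product problem $\mathbf S_d=S_1\otimes\cdots\otimes S_1$ ($d$ factors) on $\mathbf F_d=F_1\otimes\cdots\otimes F_1$ satisfies $$e(n,\mathbf S_d)^2\ge 1-n\,2^{-d}.$$ In particular, it suffers from the curse of dimensionality, since at least $2^d(1-\varepsilon^2)$ function values are needed to achieve the error $\varepsilon$, i.e. $n(\varepsilon,\mathbf S_d)\ge 2^d(1-\varepsilon^2)$.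
   Context: For a RKHS $F$ of real-valued functions on a set $D$ and a continuous linear functional $S$ on $F$, $$e(n,S)=\inf_{x_1,\dots,x_n\in D}\ \inf_{c\in\mathbb R^n}\ \sup_{\|f\|_F\le1}\Bigl|S(f)-\sum_{j=1}^nc_jf(x_j)\Bigr|,\qquad n(\varepsilon,S)=\min\{n: e(n,S)\le\varepsilon\}.$$ Tensor products: if $F_1$ has kernel $K_1$, then $\mathbf F_d$ is the RKHS on $D_1^d$ with kernel $\mathbf K_d(x,y)=\prod_{i=1}^dK_1(x^i,y^i)$; if $S_1=\langle\cdot,h_1\rangle$, then $\mathbf S_d=\langle\cdot,\mathbf h_d\rangle$ with $\mathbf h_d(t)=\prod_{i=1}^dh_1(t^i)$. The curse of dimensionality means that, for a fixed error demand $\varepsilon\in(0,1)$, the number $n(\varepsilon,\mathbf S_d)$ grows at least exponentially in $d$ (there are $c>0$, $a>1$ with $n(\varepsilon,\mathbf S_d)\ge c\,a^d$ for all $d$). *)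

(* Defs.v *)
From mathcomp Require Export all_boot all_order all_algebra.
From mathcomp Require Export all_classical all_reals all_analysis.
Export Order.TTheory GRing.Theory Num.Theory.
Export numFieldNormedType.Exports.

Set Implicit Arguments.
Unset Strict Implicit.
Unset Printing Implicit Defensive.

Local Open Scope classical_set_scope.
Local Open Scope ring_scope.

(* A Hilbert space (a complete normed space whose norm comes from an inner
   product) of real-valued functions on D with continuous point evaluations.
   Its elements are identified with functions through the injection
   [rkhs_eval]. *)
Record rkhs (R : realType) (D : Type) := RKHS {
  rkhs_space :> completeNormedModType R;
  inner : rkhs_space -> rkhs_space -> R;
  innerC : forall f g, inner f g = inner g f;
  inner_scalar : forall g, scalar (fun f => inner f g);
  inner_norm : forall f, inner f f = `|f| ^+ 2;
  rkhs_eval : rkhs_space -> D -> R;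
  rkhs_eval_scalar : forall x, scalar (fun f => rkhs_eval f x);
  rkhs_eval_inj : injective rkhs_eval;
  rkhs_eval_continuous : forall x, continuous (fun f => rkhs_eval f x)
}.

Arguments inner {R D} F : rename.
Arguments rkhs_eval {R D} F : rename.

Section RKHS.
Context {R : realType} {D : Type}.
Implicit Types (F : rkhs R D) (g : D -> R).

Definition in_rkhs F g : Prop := exists f : F, rkhs_eval F f = g.

(* The element of F that is the function g (meaningful when [in_rkhs F g]). *)
Definition elt F g : F := xget 0 [set f | rkhs_eval F f = g].

(* The h in F with S = <., h>; for continuous linear S it exists and is unique
   by the Riesz representation theorem. *)
Definition representer F (S : F -> R) : F :=
  xget 0 [set h | forall f, S f = inner F f h].

(* K(x, .) is the representer of the evaluation at x. *)
Definition kernel F (x y : D) : R :=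
  rkhs_eval F (representer (fun f : F => rkhs_eval F f x)) y.

Local Open Scope ereal_scope.

Definition worst_case_error F (S : F -> R) (n : nat)
    (x : 'I_n -> D) (c : 'I_n -> R) : \bar R :=
  ereal_sup [set `|S f - \sum_(j < n) c j * rkhs_eval F f (x j)|%R%:E
            | f in [set f : F | (`|f| <= 1)%R]].

Definition minimal_error F (S : F -> R) (n : nat) : \bar R :=
  ereal_inf (range (fun x : 'I_n -> D =>
    ereal_inf (range (fun c : 'I_n -> R => worst_case_error S x c)))).

(* min {n | e(n, S) <= eps}, with the convention that it is +oo when there is
   no such n. *)
Definition information_complexity F (S : F -> R) (eps : R) : \bar R :=
  ereal_inf [set n%:R%:E | n in [set n : nat | minimal_error S n <= eps%:E]].

End RKHS.

(* Fd is the d-fold tensor power of F1: an RKHS is determined by its kernel. *)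
Definition is_tensor_power (R : realType) (D1 : Type) (F1 : rkhs R D1)
    (d : nat) (Fd : rkhs R ('I_d -> D1)) : Prop :=
  forall x y : 'I_d -> D1,
    kernel Fd x y = \prod_(i < d) kernel F1 (x i) (y i).

(* f |-> <f, h_d>, where h_d(t) = \prod_i h_1(t^i) and S1 = <., h_1>. *)
Definition tensor_functional (R : realType) (D1 : Type) (F1 : rkhs R D1)
    (S1 : F1 -> R) (d : nat) (Fd : rkhs R ('I_d -> D1)) : Fd -> R :=
  fun f => inner Fd f
    (elt Fd (fun t => \prod_(i < d) rkhs_eval F1 (representer S1) (t i))).

(* [N eps d] is the information complexity of the d-th problem. *)
Definition curse_of_dimensionality (R : realType) (N : R -> nat -> \bar R) :
    Prop :=
  forall eps : R, 0 < eps < 1 ->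
    exists c a : R, [/\ 0 < c, 1 < a &
      forall d : nat, ((c * a ^+ d)%:E <= N eps d)%E].

(* Main.v *)
Require Import Defs.
From mathcomp Require Import ring lra.

Set Implicit Arguments.
Unset Strict Implicit.
Unset Printing Implicit Defensive.

Local Open Scope classical_set_scope.
Local Open Scope ring_scope.

(* Put v(t) = (x)_i (e_1(t^i), e_2(t^i)), a vector of dimension 2^d.  For a
   2^d x 2^d matrix B, the function f_B(t) = <B v(t), v(t)> lies in the tensor
   power, |f_B| is at most the Frobenius norm of B, and S_d f_B is
   2^(-d/2) tr B.  Given points x_1, ..., x_n, let B be the orthogonal
   projector onto the complement of the span of the v(x_j): then f_B vanishes
   at every x_j and tr B = |B|^2 >= 2^d - n, so no choice of weights has an
   error below (1 - n 2^-d)^(1/2).  The tensor power being known only through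
   its kernel, product functions are put in it by extending the map
   K(x, .) |-> K_d((.., x, ..), .), which multiplies inner products by a
   constant, one coordinate at a time. *)

(** * Representation of bounded functionals *)

Section InnerProduct.
Context {R : realType} {D : Type}.
Variable F : rkhs R D.
Implicit Types u v w h : F.
Local Notation ip := (inner F).

Lemma inner_linear w : linear_for *%R (ip ^~ w).
Proof. by move=> a u v; rewrite inner_scalar. Qed.

Lemma inner0l w : ip 0 w = 0.
Proof.
have := inner_linear w 1 0 0; rewrite scaler0 addr0 mul1r => /eqP.
by rewrite -subr_eq0 opprD addNKr oppr_eq0 => /eqP.
Qed.

Lemma innerDl w u v : ip (u + v) w = ip u w + ip v w.
Proof. by have := inner_linear w 1 u v; rewrite scale1r mul1r. Qed.

Lemma innerZl w (a : R) u : ip (a *: u) w = a * ip u w.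
Proof. by have := inner_linear w a u 0; rewrite !addr0 inner0l addr0. Qed.

Lemma innerBl w u v : ip (u - v) w = ip u w - ip v w.
Proof. by rewrite innerDl -scaleN1r innerZl mulN1r. Qed.

Lemma inner_suml w I (s : seq I) (P : pred I) (f : I -> F) :
  ip (\sum_(i <- s | P i) f i) w = \sum_(i <- s | P i) ip (f i) w.
Proof.
by apply: (big_morph (ip ^~ w)) => [u v|]; rewrite ?innerDl ?inner0l.
Qed.

Lemma inner_sumr w I (s : seq I) (P : pred I) (f : I -> F) :
  ip w (\sum_(i <- s | P i) f i) = \sum_(i <- s | P i) ip w (f i).
Proof. by rewrite innerC inner_suml; apply: eq_bigr => i _; rewrite innerC. Qed.

Lemma innerDr w u v : ip w (u + v) = ip w u + ip w v.
Proof. by rewrite innerC innerDl !(innerC _ w). Qed.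

Lemma innerZr w (a : R) u : ip w (a *: u) = a * ip w u.
Proof. by rewrite innerC innerZl (innerC w). Qed.

Lemma innerBr w u v : ip w (u - v) = ip w u - ip w v.
Proof. by rewrite innerC innerBl !(innerC _ w). Qed.

Lemma inner0r w : ip w 0 = 0.
Proof. by rewrite innerC inner0l. Qed.

Definition innerE :=
  (innerBl, innerBr, innerDl, innerDr, innerZl, innerZr, inner0l, inner0r).

Lemma inner_ge0 u : 0 <= ip u u.
Proof. by rewrite inner_norm exprn_ge0. Qed.

Lemma inner_eq0 u : ip u u = 0 -> u = 0.
Proof. by rewrite inner_norm => /eqP; rewrite expf_eq0 normr_eq0 => /eqP. Qed.

Lemma norm_lt u (e : R) : 0 < e -> (`|u| < e) = (ip u u < e ^+ 2).
Proof. by move=> e0; rewrite inner_norm ltr_sqr // ?nnegrE // ltW. Qed.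

Lemma norm_le u (e : R) : 0 <= e -> (`|u| <= e) = (ip u u <= e ^+ 2).
Proof. by move=> e0; rewrite inner_norm ler_sqr // ?nnegrE. Qed.

(** The discriminant criterion, used both for Cauchy-Schwarz and for the first order condition in
    [graph_representer]. When [a = 0] the form is affine in [t], and a nonzero [b] would let it
    reach -1. *)
Lemma quadratic_ge0 (a b c : R) : 0 <= a ->
  (forall t, 0 <= a * t ^+ 2 - 2 * b * t + c) -> b ^+ 2 <= a * c.
Proof.
move=> a0 q; have [a_eq0|an0] := eqVneq a 0.
  rewrite a_eq0 mul0r; have [->|bn0] := eqVneq b 0; first by rewrite expr0n.
  have := q ((c + 1) / (2 * b)).
  have -> : a * ((c + 1) / (2 * b)) ^+ 2 - 2 * b * ((c + 1) / (2 * b)) + c = -1.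
    by rewrite a_eq0; field.
  lra.
have := q (b / a).
have -> : a * (b / a) ^+ 2 - 2 * b * (b / a) + c = (a * c - b ^+ 2) / a.
  by field.
by rewrite pmulr_lge0 ?invr_gt0 ?lt_neqAle 1?eq_sym ?an0 // subr_ge0.
Qed.

Lemma cauchy_schwarz u v : ip u v ^+ 2 <= ip u u * ip v v.
Proof.
apply: quadratic_ge0 => [|t]; first exact: inner_ge0.
have := inner_ge0 (t *: u - v); rewrite !innerE (innerC v u).
move=> /le_trans; apply.
by rewrite le_eqVlt; apply/orP; left; apply/eqP; ring.
Qed.

Lemma parallelogram u v :
  ip (u - v) (u - v) = 2 * ip u u + 2 * ip v v - ip (u + v) (u + v).
Proof. rewrite !innerE (innerC v u); ring. Qed.

(* The minimizer of [|u|^2 / 2 - a] over the graph G: its first order condition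
   is the representation property. *)
Lemma graph_representer (G : F -> R -> Prop) (C : R) :
    0 <= C -> G 0 0 ->
    (forall (r : R) u v (a b : R),
      G u a -> G v b -> G (r *: u + v) (r * a + b)) ->
    (forall u a, G u a -> a ^+ 2 <= C * ip u u) ->
  exists h, (forall u a, G u a -> ip u h = a) /\ ip h h <= C.
Proof.
move=> C0 G0 GD GC.
pose Q u (a : R) : R := ip u u - 2 * a.
pose E := [set q | exists u a, G u a /\ q = Q u a].
(* On [G], [2 |a| <= 2 sqrt (C |u|^2) <= C + |u|^2], so [Q] is bounded below. *)
have QC u a : G u a -> - C <= Q u a.
  move=> /GC le; have : `|2 * a| <= `|ip u u + C|.
    rewrite -ler_sqr ?nnegrE // !real_normK ?num_real //.
    by have := sqr_ge0 (ip u u - C); nra.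
  rewrite [X in _ <= X]ger0_norm ?addr_ge0 ?inner_ge0 // /Q.
  by have := ler_norm (2 * a); lra.
have Elb : lbound E (- C) by move=> _ [u [a [Ga ->]]]; exact: QC.
have Einf : has_inf E by split; [exists (Q 0 0), 0, 0 | exists (- C)].
have [eps eps0 eps_small] : exists2 eps : nat -> R, forall n, 0 < eps n &
    forall e : R, 0 < e -> \forall n \near \oo, eps n < e.
  exists (fun n => n.+1%:R^-1) => [n|e e0]; first by rewrite invr_gt0.
  exact: near_infty_natSinv_lt (PosNum e0).
have [m mE mP] : exists2 m : R, forall u a, G u a -> m <= Q u a &
    forall n, exists p : F * R, G p.1 p.2 /\ Q p.1 p.2 < m + eps n.
  exists (inf E) => [u a Ga|n].
    by apply: ge_inf; [exists (- C) | exists u, a].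
  have [_ [u [a [Ga ->]]] lt] := inf_adherent (eps0 n) Einf.
  by exists (u, a).
have [ua uaP] := choice mP; clear E Elb Einf.
pose u n := (ua n).1.
(* The midpoint of [u n] and [v] stays in the graph, so [Q] is at least [m] there; the parallelogram
   law then forces near-minimizers to be close. *)
have near_min (k : R) n v (b : R) : G v b -> Q v b <= m + k ->
    ip (u n - v) (u n - v) <= 2 * (eps n + k).
  move=> Gv Qv; have [Gu Qu] := uaP n; rewrite -/(u n) in Gu Qu.
  have := mE _ _ (GD 2^-1 _ _ _ _ (GD 1 _ _ _ _ Gu Gv) G0).
  rewrite parallelogram /Q -/(u n) !innerE (innerC v) in Qu Qv *.
  lra.
have u_close (e : R) : 0 < e ->
    exists N, forall n, (N <= n)%N -> `|u N - u n| < e.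
  move=> e0.
  have /eps_small[N _ HN] : 0 < e ^+ 2 / 4 by rewrite divr_gt0 ?exprn_gt0.
  exists N => n Nn; have [Gn Qn] := uaP n.
  have := near_min (eps n) N _ _ Gn (ltW Qn); rewrite -/(u n).
  have := HN _ Nn; have := HN _ (leqnn N); rewrite /= => lN ln le.
  rewrite norm_lt //; lra.
have u_cauchy : cauchy (u n @[n --> \oo]).
  apply: cauchy_exP => e /u_close[N HN].
  by exists (u N), N => // n /= /HN; rewrite -ball_normE.
have /cauchy_cvg/cvg_ex[h uh] := u_cauchy.
move/cvgrPdistC_lt: uh => uh.
have uhP (e : R) : 0 < e ->
    exists n, eps n <= e /\ ip (u n - h) (u n - h) <= e.
  move=> e0; have [N1 _ N1P] := eps_small e e0.
  have /uh[N2 _ N2P] : 0 < Num.sqrt e by rewrite sqrtr_gt0.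
  exists (maxn N1 N2); split; first by apply/ltW/N1P; rewrite /= leq_maxl.
  have := N2P (maxn N1 N2); rewrite /= leq_maxr => /(_ isT).
  by rewrite norm_lt ?sqrtr_gt0 // sqr_sqrtr ?(ltW e0) // => /ltW.
have hP v b : G v b -> ip v h = b.
  move=> Gv; have v0 := inner_ge0 v.
  (* For every [t], [Q] at [t v + u n] is at least [m], hence larger than its value at [u n] minus
     [eps n]. The discriminant of this quadratic in [t] gives the bound. *)
  have approx n : (ip v (u n) - b) ^+ 2 <= ip v v * eps n.
    rewrite -sqrrN opprB; apply: quadratic_ge0 => [//|t].
    have [Gu] := uaP n; rewrite -/(u n) => Qu.
    have := mE _ _ (GD t _ _ _ _ Gv Gu).
    by rewrite /Q !innerE (innerC (u n) v) in Qu *; nra.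
  have small (e : R) : 0 < e -> (ip v h - b) ^+ 2 <= 4 * ip v v * e.
    move=> /uhP[n [n_small h_near]].
    have := cauchy_schwarz v (u n - h); have := approx n.
    have := ler_wpM2l v0 h_near; have := ler_wpM2l v0 n_small.
    rewrite (innerBr v); set x := ip v h; set y := ip v (u n).
    have -> : (x - b) ^+ 2 =
      2 * (y - x) ^+ 2 + 2 * (y - b) ^+ 2 - (2 * y - x - b) ^+ 2 by ring.
    have := sqr_ge0 (2 * y - x - b).
    move: (ip v v * eps n) (ip v v * ip (u n - h) (u n - h)) => A B; lra.
  apply/eqP; rewrite -subr_eq0 -sqrf_eq0 eq_le sqr_ge0 andbT leNgt.
  apply/negP => d0; set d := _ ^+ 2 in d0 small.
  have v1 : 0 < ip v v + 1 by lra.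
  (* This choice makes [4 |v|^2 e] smaller than [d / 2]; the added 1 covers [v = 0]. *)
  have e0 : 0 < d / (8 * (ip v v + 1)) by rewrite divr_gt0 // mulr_gt0.
  have := small _ e0; have -> : 4 * ip v v * (d / (8 * (ip v v + 1))) =
    d / 2 - d / (2 * (ip v v + 1)) by field; lra.
  have : 0 < d / (2 * (ip v v + 1)) by rewrite divr_gt0 // mulr_gt0.
  lra.
(* With [a = <u n, h>], [Q] at [u n] equals [|u n - h|^2 - |h|^2], and it is at least [- C]. *)
exists h; split=> //; apply/ler_addgt0Pr => e /uhP[n [_ h_near]].
have [Gu _] := uaP n; have := QC _ _ Gu; rewrite /Q -(hP _ _ Gu) -/(u n).
by rewrite !innerE (innerC h) in h_near *; lra.
Qed.

(** The Riesz theorem: [graph_representer] is applied to the graph of [S], the bound [C] coming from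
    continuity at 0. *)
Lemma representerP (S : F -> R) : scalar S -> continuous S ->
  forall f, S f = ip f (representer S).
Proof.
move=> Slin Scont.
suff [h hP] : exists h, forall f, S f = ip f h.
  by rewrite /representer; case: xgetP => [? -> //|/(_ h)/(_ hP)].
have S0 : S 0 = 0.
  have := Slin 1 0 0; rewrite scaler0 addr0 mul1r => /eqP.
  by rewrite -subr_eq0 opprD addNKr oppr_eq0 => /eqP.
have SZ a f : S (a *: f) = a * S f by rewrite -[_ *: f]addr0 Slin S0 addr0.
have [d d0 dP] : exists2 d : R, 0 < d &
    forall f, ip f f < d ^+ 2 -> S f ^+ 2 <= 1.
  have /cvgrPdist_lt/(_ 1 ltr01)/nbhs_ballP[d /= d0 dP] := Scont 0.
  exists d => // f; rewrite -norm_lt // => fd.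
  have := dP f; rewrite -ball_normE /= sub0r normrN => /(_ fd).
  rewrite S0 sub0r normrN => /ltW; rewrite -(@expr_le1 _ 2) //.
  by rewrite real_normK ?num_real.
have [h hP] : exists h, forall f a, S f = a -> ip f h = a.
  suff [h [hP _]] : exists h, (forall f a, S f = a -> ip f h = a) /\
      ip h h <= 4 / d ^+ 2 by exists h.
  apply: graph_representer; rewrite ?divr_ge0 ?sqr_ge0 //.
    by move=> r f g _ _ <- <-; rewrite Slin.
  move=> f _ <-; have [->|fn0] := eqVneq f 0.
    by rewrite S0 expr0n inner0l mulr0.
  have f0 : 0 < ip f f.
    rewrite lt_neqAle inner_ge0 andbT eq_sym.
    by apply/eqP => /inner_eq0 /eqP; apply/negP.
  set n := Num.sqrt (ip f f).
  have n2 : n ^+ 2 = ip f f by rewrite sqr_sqrtr ?ltW.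
  have n0 : 0 < n by rewrite sqrtr_gt0.
  (* Rescaling [f] to norm [d / 2] keeps it strictly inside the ball of radius [d]; this is where
     the constant [4 / d ^+ 2] comes from. *)
  have : S ((d / (2 * n)) *: f) ^+ 2 <= 1.
    apply: dP; rewrite innerZl innerZr -n2.
    have -> : d / (2 * n) * (d / (2 * n) * n ^+ 2) = d ^+ 2 / 4.
      by field; rewrite gt_eqF.
    by have := exprn_gt0 2 d0; lra.
  rewrite SZ exprMn -n2 => le1.
  have -> : S f ^+ 2 = 4 / d ^+ 2 * n ^+ 2 * ((d / (2 * n)) ^+ 2 * S f ^+ 2).
    by field; rewrite !gt_eqF.
  by rewrite ler_piMr // mulr_ge0 ?divr_ge0 ?sqr_ge0.
by exists h => f; rewrite (hP _ _ erefl).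
Qed.

Definition kern x : F := representer (fun f : F => rkhs_eval F f x).

Lemma kernE f x : rkhs_eval F f x = ip f (kern x).
Proof.
exact: representerP (rkhs_eval_scalar x) (@rkhs_eval_continuous _ _ F x) f.
Qed.

Lemma inner_kern x y : ip (kern x) (kern y) = kernel F x y.
Proof. by rewrite -kernE. Qed.

Lemma eltP g : in_rkhs F g -> rkhs_eval F (elt F g) = g.
Proof. by move=> [f fP]; rewrite /elt; case: xgetP => [//|/(_ f)/(_ fP)]. Qed.

Lemma elt_eval f : elt F (rkhs_eval F f) = f.
Proof. by apply: rkhs_eval_inj; apply: eltP; exists f. Qed.

End InnerProduct.

(** * Tensor powers *)

(* The adjoint [A] of the extension is constructed first, [A v] being the
   element of [F] with values [<u s, v>]; then [w] represents [<q, A v>]. *)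
Lemma scaled_isometry_extension (R : realType) (D D' : Type) (F : rkhs R D)
    (E : rkhs R D') (C : R) (u : D -> E) :
    0 <= C ->
    (forall s r, inner E (u s) (u r) = C * kernel F s r) ->
  forall q : F, exists w : E, forall v (p : F),
    (forall s, rkhs_eval F p s = inner E (u s) v) -> inner E w v = inner F q p.
Proof.
move=> C0 uC q.
(* A list encodes a finite combination. As [graph_representer] takes a relation, the map from [K c]
   to [U c] need not be shown single-valued, and no density of the kernel sections is invoked. *)
pose K (c : seq (R * D)) : F := \sum_(p <- c) p.1 *: kern F p.2.
pose U (c : seq (R * D)) : E := \sum_(p <- c) p.1 *: u p.2.
have UK c : inner E (U c) (U c) = C * inner F (K c) (K c).
  rewrite !inner_suml mulr_sumr; apply: eq_bigr => p _.
  rewrite !inner_sumr mulr_sumr; apply: eq_bigr => r _.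
  by rewrite !innerE uC inner_kern; ring.
have scale_cat (r : R) (c1 c2 : seq (R * D)) (V : lmodType R) (g : D -> V) :
    \sum_(p <- [seq (r * p.1, p.2) | p <- c1] ++ c2) p.1 *: g p.2 =
    r *: (\sum_(p <- c1) p.1 *: g p.2) + \sum_(p <- c2) p.1 *: g p.2.
  rewrite big_cat big_map scaler_sumr; congr (_ + _).
  by apply: eq_bigr => p _; rewrite scalerA.
have /choice[A AP] v : exists p : F,
    (forall s, rkhs_eval F p s = inner E (u s) v) /\
    inner F p p <= C * inner E v v.
  have [||r p q' a b [c [-> ->]] [c' [-> ->]]||h [hP hle]] := @graph_representer
    _ _ F (fun p a => exists c, p = K c /\ a = inner E (U c) v)
    (C * inner E v v).
  - by rewrite mulr_ge0 // inner_ge0.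
  - by exists [::]; rewrite /K /U !big_nil inner0l.
  - exists ([seq (r * p.1, p.2) | p <- c] ++ c').
    by rewrite /K /U !scale_cat !innerE.
  - move=> p _ [c [-> ->]]; apply: le_trans (cauchy_schwarz _ _) _.
    by rewrite UK mulrAC.
  exists h; split=> // s; rewrite kernE innerC; apply: hP.
  by exists [:: (1, s)]; rewrite /K /U !big_seq1 !scale1r.
(* An element of [F] is determined by its values, so the chosen [A] is forced, and therefore
   linear. *)
have Auniq v p : (forall s, rkhs_eval F p s = inner E (u s) v) -> p = A v.
  by move=> pv; apply: rkhs_eval_inj; apply/funext => s; rewrite pv (AP v).1.
have Alin (r : R) v1 v2 : A (r *: v1 + v2) = r *: A v1 + A v2.
  apply/esym/Auniq => s.
  by rewrite rkhs_eval_scalar !(AP _).1 !innerE.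
have [||r v1 v2 a b -> ->||w [wP _]] := @graph_representer
    _ _ E (fun v a => a = inner F q (A v)) (C * inner F q q).
- by rewrite mulr_ge0 // inner_ge0.
- have := Alin (-1) 0 0; rewrite scaler0 addr0 scaleN1r addNr => ->.
  by rewrite inner0r.
- by rewrite Alin !innerE.
- move=> v _ ->; apply: le_trans (cauchy_schwarz _ _) _.
  have := (AP v).2; have := inner_ge0 q; nra.
by exists w => v p /Auniq ->; rewrite innerC; apply: wP.
Qed.

Section TensorPower.
Context {R : realType} {D1 : Type}.
Variables (F1 : rkhs R D1) (d : nat) (Fd : rkhs R ('I_d -> D1)).
Hypothesis Fd_tensor : is_tensor_power F1 Fd.
Implicit Types (p q : 'I_d -> F1) (t : 'I_d -> D1).

Definition tprod q : ('I_d -> D1) -> R :=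
  fun t => \prod_(i < d) rkhs_eval F1 (q i) (t i).

Lemma kernel_tprod t :
  rkhs_eval Fd (kern Fd t) = tprod (fun i => kern F1 (t i)).
Proof. by apply/funext => s; exact: Fd_tensor. Qed.

(** Induction on the number [k] of leading coordinates allowed to hold arbitrary elements of [F1],
    the others holding kernel sections. For [k = 0] this is the kernel formula; each step frees one
    coordinate by [scaled_isometry_extension]; at [k = d] no restriction is left. *)
Lemma tprod_partial k :
    let sections_from q :=
      forall i : 'I_d, (k <= i)%N -> exists x, q i = kern F1 x in
  (forall q, sections_from q -> in_rkhs Fd (tprod q)) /\
  (forall p q, sections_from p -> sections_from q ->
     inner Fd (elt Fd (tprod p)) (elt Fd (tprod q)) =
     \prod_(i < d) inner F1 (p i) (q i)).
Proof.
elim: k => [|k [IHin IHinner]] sections_from.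
  have sectionE q : sections_from q ->
      exists t, (forall i, q i = kern F1 (t i)) /\
        tprod q = rkhs_eval Fd (kern Fd t).
    move=> qP; have /choice[t tP] i := qP i isT.
    by exists t; split=> //; rewrite kernel_tprod; congr tprod; apply/funext.
  split=> [q /sectionE[t [_ ->]]|p q /sectionE[t [pt ->]] /sectionE[s [qs ->]]].
    by exists (kern Fd t).
  rewrite !elt_eval inner_kern Fd_tensor; apply: eq_bigr => i _.
  by rewrite pt qs inner_kern.
have [dk|kd] := leqP d k.
  have vacuous q (i : 'I_d) : (k <= i)%N -> exists x, q i = kern F1 x.
    by move=> ki; have := leq_ltn_trans ki (ltn_ord i); rewrite ltnNge dk.
  by split=> *; [apply: IHin | apply: IHinner]; apply: vacuous.
pose j := Ordinal kd.
pose upd q s i := if i == j then kern F1 s else q i.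
have updP q s : sections_from q ->
    forall i : 'I_d, (k <= i)%N -> exists x, upd q s i = kern F1 x.
  move=> qP i ki; rewrite /upd; case: eqP => [_|/eqP ij]; first by exists s.
  apply: qP; rewrite ltn_neqAle ki andbT; apply: contra ij => /eqP ki'.
  exact/eqP/val_inj.
have prod_upd (f : 'I_d -> F1 -> R) q s : \prod_i f i (upd q s i) =
    f j (kern F1 s) * \prod_(i | i != j) f i (q i).
  rewrite (bigD1 j) //= /upd eqxx; congr (_ * _).
  by apply: eq_bigr => i /negbTE ->.
pose u q s := elt Fd (tprod (upd q s)).
have u_inner p q s r : sections_from p -> sections_from q ->
    inner Fd (u p s) (u q r) =
    \prod_(i | i != j) inner F1 (p i) (q i) * kernel F1 s r.
  move=> pP qP; rewrite IHinner; try exact: updP.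
  rewrite (bigD1 j) //= /upd eqxx inner_kern mulrC; congr (_ * _).
  by apply: eq_bigr => i /negbTE ->.
have ext q : sections_from q ->
    in_rkhs Fd (tprod q) /\ forall v (f : F1),
    (forall s, rkhs_eval F1 f s = inner Fd (u q s) v) ->
    inner Fd (elt Fd (tprod q)) v = inner F1 (q j) f.
  move=> qP; have [||w wP] := @scaled_isometry_extension _ _ _ F1 Fd
    (\prod_(i | i != j) inner F1 (q i) (q i)) (u q) _ _ (q j).
  - by apply: prodr_ge0 => i _; apply: inner_ge0.
  - by move=> s r; rewrite u_inner.
  suff <- : rkhs_eval Fd w = tprod q by split; [exists w | rewrite elt_eval].
  apply/funext => t; rewrite kernE.
  (* Against the kernel section of [Fd] at [t], the function [s |-> <u q s, .>] is [c] times the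
     kernel section of [F1] at [t j], so [w] takes the value [tprod q t]. *)
  pose c := \prod_(i | i != j) rkhs_eval F1 (q i) (t i).
  rewrite (wP _ (c *: kern F1 (t j))) /c.
    by rewrite innerE -kernE /tprod [RHS](bigD1 j) //= mulrC.
  move=> s; rewrite -kernE eltP; last by apply: IHin; apply: updP.
  rewrite /tprod (prod_upd (fun i f => rkhs_eval F1 f (t i))).
  by rewrite !kernE innerE (innerC _ (kern F1 s)) mulrC.
split=> [q /ext[] //|p q pP qP].
have [_ pE] := ext p pP; have [_ qE] := ext q qP.
set c := \prod_(i | i != j) inner F1 (p i) (q i).
(* [ext] is used twice: for [p] it asks for the element of [F1] with values [<u p s, tprod q>], and
   these values are computed by [ext] for [q]. *)
rewrite (pE _ (c *: q j)) => [|s].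
  by rewrite innerE [RHS](bigD1 j) //= mulrC.
rewrite innerC (qE _ (c *: kern F1 s)) => [|r].
  by rewrite !kernE !innerE.
rewrite kernE innerE inner_kern u_inner //; congr (_ * _).
  by apply: eq_bigr => i _; rewrite innerC.
by rewrite -!inner_kern innerC.
Qed.

Lemma tprod_in q : in_rkhs Fd (tprod q).
Proof. by apply: (tprod_partial d).1 => i; rewrite leqNgt ltn_ord. Qed.

Lemma inner_tprod p q :
  inner Fd (elt Fd (tprod p)) (elt Fd (tprod q)) =
  \prod_(i < d) inner F1 (p i) (q i).
Proof. by apply: (tprod_partial d).2 => i; rewrite leqNgt ltn_ord. Qed.

End TensorPower.

(** * Projectors and symmetrization *)

(** Gram-Schmidt by induction on [n]: subtracting the projector onto the line of [w], the image of
    the new vector under [B], kills that vector and lowers the trace by 1. If [w = 0], [B] is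
    kept. *)
Lemma annihilating_projector (R : realFieldType) (N n : nat)
    (V : 'I_n -> 'cV[R]_N) :
  exists B : 'M[R]_N, [/\ B^T = B, B *m B = B, forall j, B *m V j = 0 &
    N%:R - n%:R <= \tr B].
Proof.
elim: n V => [|n IHn] V.
  exists 1%:M; split; rewrite ?trmx1 ?mulmx1 ?mxtrace1 ?subr0 //.
  by case.
have [B [Bt BB BV Btr]] := IHn (fun j => V (lift ord0 j)).
pose w := B *m V ord0; pose s := (w^T *m w) 0 0.
have wws : w^T *m w = s%:M by rewrite [LHS]mx11_scalar.
have [w0|wn0] := eqVneq w 0.
  exists B; split=> // [j|]; first by case: (unliftP ord0 j) => [i|] ->.
  by apply: le_trans Btr; rewrite lerD2l lerN2 ler_nat.
have s0 : s != 0.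
  apply: contra wn0 => /eqP; rewrite /s mxE => /psumr_eq0P w0.
  apply/eqP/colP => i; rewrite [RHS]mxE; apply/eqP; rewrite -sqrf_eq0 expr2.
  have := w0 _ i isT; rewrite mxE => -> // k _.
  by rewrite mxE -expr2 sqr_ge0.
have Bw : B *m w = w by rewrite mulmxA BB.
have wB : w^T *m B = w^T by rewrite -{1}Bt -trmx_mul Bw.
(* Hence whatever [B] kills is orthogonal to [w], and the old vectors remain annihilated. *)
have wV v : w^T *m v = (V ord0)^T *m (B *m v).
  by rewrite trmx_mul Bt mulmxA.
exists (B - s^-1 *: (w *m w^T)); split.
- by rewrite linearB linearZ /= trmx_mul trmxK Bt.
- have BP : B *m (w *m w^T) = w *m w^T by rewrite mulmxA Bw.
  have PB : w *m w^T *m B = w *m w^T by rewrite -mulmxA wB.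
  have PP : w *m w^T *m (w *m w^T) = s *: (w *m w^T).
    by rewrite -mulmxA (mulmxA w^T) wws mul_scalar_mx -scalemxAr.
  rewrite mulmxBl !mulmxBr BB -!scalemxAl -!scalemxAr BP PB PP.
  by rewrite [s^-1 *: (s *: _)]scalerA mulVf // scale1r subrr subr0.
- move=> j; rewrite mulmxBl -scalemxAl -mulmxA wV.
  case: (unliftP ord0 j) => [i|] ->.
    by rewrite BV !mulmx0 scaler0 subr0.
  rewrite -/w -Bw -wV Bw wws mul_mx_scalar scalerA mulVf // scale1r.
  by rewrite subrr.
- rewrite linearB linearZ /= mxtrace_mulC wws mxtrace_scalar mulr1n mulVf //.
  by rewrite -[n.+1]addn1 natrD opprD addrA lerD2r.
Qed.

(** The squared Frobenius norm is the trace of [B B^T], which equals [B] for a symmetric idempotent.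
    Indexing by a finite type lets multi-indices serve as rows and columns. *)
Lemma annihilating_projector_fin (R : realFieldType) (A : finType) (n : nat)
    (v : 'I_n -> A -> R) :
  exists B : A -> A -> R, [/\
    forall j a, \sum_b B a b * v j b = 0,
    \sum_a \sum_b B a b ^+ 2 = \sum_a B a a &
    #|A|%:R - n%:R <= \sum_a B a a].
Proof.
have [B [Bt BB BV Btr]] :=
  annihilating_projector (fun j => \col_(i < #|A|) v j (enum_val i)).
have sumE (f : 'I_#|A| -> R) : \sum_a f (enum_rank a) = \sum_i f i.
  by rewrite [RHS](reindex enum_rank) //; apply: onW_bij; apply: enum_rank_bij.
exists (fun a b => B (enum_rank a) (enum_rank b)); split=> [j a||].
- have /colP/(_ (enum_rank a)) := BV j; rewrite mxE [RHS]mxE.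
  by rewrite -sumE; under eq_bigr do rewrite mxE enum_rankK.
- transitivity (\sum_i \sum_j B i j ^+ 2).
    by rewrite -sumE; apply: eq_bigr => a _; rewrite -sumE.
  transitivity (\sum_i B i i); last by rewrite -sumE.
  apply: eq_bigr => i _; rewrite -[in RHS]BB mxE; apply: eq_bigr => j _.
  by rewrite expr2 -{2}Bt mxE.
- by apply: le_trans Btr _; rewrite /mxtrace -sumE.
Qed.

Section SwapAverage.
Variables (R : realFieldType) (d : nat).
Local Notation A := {ffun 'I_d -> bool}.

Definition swap (s : A) (p : A * A) : A * A :=
  ([ffun i => if s i then p.2 i else p.1 i],
   [ffun i => if s i then p.1 i else p.2 i]).

Lemma swapK s : involutive (swap s).
Proof.
case=> a b; congr pair; apply/ffunP => i;
  by rewrite ffunE /= !ffunE; case: (s i).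
Qed.

(** The inner product of symmetrized tensors of two basis vectors. A product of two distinct ones
    has squared norm 1/2, in accordance with the normalization of [sqrt 2 e_1 e_2]. *)
Definition sym_inner (a b c e : bool) : R :=
  (((a == c) && (b == e))%:R + ((a == e) && (b == c))%:R) / 2.

(** Each factor is a sum of two terms, matching the indices straight or crossed. In the expansion,
    [s] records the crossed coordinates, and its term survives exactly when [r] is the corresponding
    swap of [p]. *)
Lemma prod_sym_inner (p r : A * A) :
  \prod_(i < d) sym_inner (p.1 i) (p.2 i) (r.1 i) (r.2 i) =
  \sum_(s : A) (r == swap s p)%:R / 2 ^+ d.
Proof.
pose h i (s : bool) : R := (if s then (p.1 i == r.2 i) && (p.2 i == r.1 i)
  else (p.1 i == r.1 i) && (p.2 i == r.2 i))%:R / 2.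
transitivity (\prod_(i < d) \sum_(s : bool) h i s).
  by apply: eq_bigr => i _; rewrite big_bool /h /sym_inner mulrDl addrC.
rewrite bigA_distr_bigA; apply: eq_bigr => s _.
rewrite big_split /= prodr_const card_ord -exprVn; congr (_ * _).
rewrite -natr_prod; congr _%:R.
have [->|/eqP rs] := eqVneq.
  by rewrite big1 // => i _; rewrite /= !ffunE; case: (s i); rewrite !eqxx.
apply/eqP; rewrite -leqn0 leqNgt; apply/negP => prod_gt0; case: rs.
have {prod_gt0} h1 i : (if s i then (p.1 i == r.2 i) && (p.2 i == r.1 i)
    else (p.1 i == r.1 i) && (p.2 i == r.2 i)).
  apply: contraTT prod_gt0 => /negbTE hi.
  by rewrite (bigD1 i) //= hi mul0n.
rewrite [r]surjective_pairing; congr pair; apply/ffunP => i; have := h1 i;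
  by rewrite ffunE; case: (s i) => /andP[/eqP p1 /eqP p2]; rewrite ?p1 ?p2.
Qed.

(* The symmetrization [sym_inner] averages the [2 ^ d] partial swaps, each of
   which preserves the Frobenius norm. *)
Lemma sym_inner_le (B : A -> A -> R) :
  \sum_p \sum_r B p.1 p.2 * B r.1 r.2 *
    \prod_(i < d) sym_inner (p.1 i) (p.2 i) (r.1 i) (r.2 i) <=
  \sum_a \sum_b B a b ^+ 2.
Proof.
pose b (p : A * A) := B p.1 p.2.
rewrite [leRHS]pair_big /= -/(\sum_p b p ^+ 2); set n2 := (X in _ <= X).
have E : (\sum_p \sum_r b p * b r *
    \prod_(i < d) sym_inner (p.1 i) (p.2 i) (r.1 i) (r.2 i)) =
    \sum_(s : A) (\sum_p b p * b (swap s p)) / 2 ^+ d.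
  under eq_bigr => p _ do
    under eq_bigr => r _ do rewrite prod_sym_inner mulr_sumr.
  rewrite [RHS](eq_bigr _ (fun s _ => mulr_suml _ _ _ _)) [RHS]exchange_big /=.
  apply: eq_bigr => p _; rewrite exchange_big /=; apply: eq_bigr => s _.
  rewrite (bigD1 (swap s p)) //= eqxx big1 ?addr0; first by rewrite mul1r.
  by move=> r /negbTE ->; rewrite !(mul0r, mulr0).
(* By [2 x y <= x^2 + y^2], since [swap s] permutes the pairs of indices. *)
rewrite [leLHS]E; have le s : \sum_p b p * b (swap s p) <= n2.
  have n2s : \sum_p b (swap s p) ^+ 2 = n2.
    by rewrite [RHS](reindex_inj (inv_inj (swapK s))).
  suff : \sum_p b p * b (swap s p) <= (n2 + n2) / 2 by lra.
  rewrite -{2}n2s -big_split /= mulr_suml; apply: ler_sum => p _.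
  have := sqr_ge0 (b p - b (swap s p)); lra.
have -> : n2 = \sum_(s : A) n2 / 2 ^+ d.
  rewrite sumr_const card_ffun card_bool card_ord -[RHS]mulr_natl natrX mulrC.
  by rewrite divfK // expf_neq0.
by apply: ler_sum => s _; rewrite ler_wpM2r ?invr_ge0 ?exprn_ge0.
Qed.

End SwapAverage.

(** * The lower bound *)

Lemma sqrt2_half_sqr (R : realType) : (Num.sqrt 2 / 2) ^+ 2 = 2^-1 :> R.
Proof. by rewrite exprMn sqr_sqrtr //; field. Qed.

Lemma worst_case_error_ge0 (R : realType) D (F : rkhs R D) (S : F -> R) n
    (x : 'I_n -> D) c :
  S 0 = 0 -> (0 <= worst_case_error S x c)%E.
Proof.
move=> S0; apply: ereal_sup_ubound; exists 0; first by rewrite /= normr0.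
rewrite S0 big1 ?subr0 ?normr0 // => j _.
by rewrite kernE inner0l mulr0.
Qed.

Section Fooling.
Context {R : realType} {D1 : Type}.
Variables (F1 : rkhs R D1) (e : bool -> D1 -> R).
Variables (E : bool -> bool -> F1) (h : F1).
Hypothesis E_eval : forall a b t, rkhs_eval F1 (E a b) t = e a t * e b t.
Hypothesis E_inner : forall a b c f,
  inner F1 (E a b) (E c f) = sym_inner R a b c f.
Hypothesis E_h : forall a b, inner F1 (E a b) h = Num.sqrt 2 / 2 * (a == b)%:R.
Variables (d : nat) (Fd : rkhs R ('I_d -> D1)).
Hypothesis Fd_tensor : is_tensor_power F1 Fd.

(* With [v t] the tensor product of the vectors [(e a (t i))_a] and [B] the
   projector onto the orthogonal complement of the [v (x j)], take
   [f t = <B (v t), v t>]; then [T] is the rank of [B]. *)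
Lemma fooling_function n (x : 'I_n -> 'I_d -> D1) : exists (f : Fd) (T : R),
  [/\ 2 ^+ d - n%:R <= T, inner Fd f f <= T,
      inner Fd f (elt Fd (tprod (fun=> h))) = (Num.sqrt 2 / 2) ^+ d * T &
      forall j, rkhs_eval Fd f (x j) = 0].
Proof.
pose A := {ffun 'I_d -> bool}.
pose v (t : 'I_d -> D1) (a : A) := \prod_(i < d) e (a i) (t i).
have [B [Bv Bnorm Btr]] := annihilating_projector_fin (fun j => v (x j)).
pose g (p : A * A) := elt Fd (tprod (fun i => E (p.1 i) (p.2 i))).
exists (\sum_p B p.1 p.2 *: g p), (\sum_a B a a); split.
- by move: Btr; rewrite card_ffun card_bool card_ord natrX.
- rewrite -Bnorm; apply: le_trans (sym_inner_le B).
  rewrite le_eqVlt; apply/orP; left; apply/eqP.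
  rewrite inner_suml; apply: eq_bigr => p _.
  rewrite inner_sumr; apply: eq_bigr => r _.
  rewrite !innerE inner_tprod // mulrA; congr (_ * _).
  by apply: eq_bigr => i _; rewrite E_inner.
- rewrite inner_suml -(pair_big xpredT xpredT
    (fun a b => inner Fd (B a b *: g (a, b)) (elt Fd (tprod (fun=> h))))) /=.
  rewrite mulr_sumr; apply: eq_bigr => a _.
  (* Off-diagonal entries contribute nothing: if [a] and [b] differ at some coordinate, the factor
     there vanishes by [E_h]. Each diagonal entry contributes the same constant. *)
  rewrite (bigD1 a) //= big1 ?addr0 => [|b ba];
    rewrite innerE inner_tprod // (eq_bigr _ (fun i _ => E_h _ _)) /=.
    rewrite big_split /= prodr_const card_ord [X in _ * (_ * X)]big1 => [|i _].
      by rewrite mulr1 mulrC.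
    by rewrite eqxx.
  have [i abi] : exists i, a i != b i.
    apply/existsP; rewrite -[X in is_true X]negbK negb_exists.
    apply: contra ba => /forallP ab; apply/eqP/ffunP => i.
    by have := ab i; rewrite negbK => /eqP.
  by rewrite (bigD1 i) //= (negbTE abi) mulr0 mul0r mulr0.
- move=> j; rewrite kernE inner_suml -(pair_big xpredT xpredT
    (fun a b => inner Fd (B a b *: g (a, b)) (kern Fd (x j)))) /=.
  rewrite big1 // => a _.
  transitivity (v (x j) a * \sum_b B a b * v (x j) b); last by rewrite Bv mulr0.
  rewrite mulr_sumr; apply: eq_bigr => b _.
  rewrite innerE -kernE eltP; last exact: tprod_in.
  rewrite /tprod (eq_bigr _ (fun i _ => E_eval _ _ _)) big_split /=.
  by rewrite mulrCA.
Qed.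

(** Divided by [sqrt T], the fooling function lies in the unit ball and every weighted sum at its
    nodes is 0, so the error is at least [2^(-d/2) sqrt T], where [T >= 2^d - n]. *)
Lemma minimal_error_ge n :
  ((Num.sqrt (1 - n%:R * 2 ^- d))%:E <=
   minimal_error (fun f => inner Fd f (elt Fd (tprod (fun=> h)))) n)%E.
Proof.
apply: le_ereal_inf_tmp => _ [x _ <-]; apply: le_ereal_inf_tmp => _ [c _ <-].
(* For [n >= 2^d] the square root takes its default value 0, and nonnegativity of the error
   suffices. *)
have [le0|] := boolP (1 - n%:R * 2 ^- d <= 0 :> R); last rewrite -ltNge => gt0.
  by rewrite ler0_sqrtr // worst_case_error_ge0 // inner0l.
have [f [T [Tge fT fh fx]]] := fooling_function x.
have pow_gt0 : 0 < 2 ^+ d :> R by rewrite exprn_gt0.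
have T0 : 0 < T.
  apply: lt_le_trans Tge; rewrite -(pmulr_lgt0 _ pow_gt0) in gt0.
  by rewrite mulrBl mul1r divfK ?gt_eqF in gt0.
have sT : 0 < Num.sqrt T by rewrite sqrtr_gt0.
apply: (@le_trans _ _ `|(Num.sqrt 2 / 2) ^+ d * Num.sqrt T|%:E).
  rewrite lee_fin -ler_sqr ?nnegrE ?sqrtr_ge0 // real_normK ?num_real //.
  rewrite sqr_sqrtr ?(ltW gt0) // exprMn -exprM mulnC exprM sqrt2_half_sqr.
  rewrite sqr_sqrtr ?(ltW T0) // -(ler_pM2l pow_gt0) mulrA -exprMn divff //.
  by rewrite expr1n mul1r mulrBr mulr1 mulrCA divff ?gt_eqF // mulr1.
apply: ereal_sup_ubound; exists ((Num.sqrt T)^-1 *: f).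
  rewrite /= norm_le // !innerE expr1n mulrA -invfM -expr2.
  rewrite sqr_sqrtr ?(ltW T0) //.
  by rewrite ler_pdivrMl // mulr1.
congr (`|_|%:E); rewrite big1 ?subr0 => [|j _].
  rewrite innerE fh -{2}(@sqr_sqrtr _ T) ?ltW // expr2.
  by rewrite [in LHS]mulrCA mulKf // gt_eqF.
by rewrite kernE innerE -kernE fx !mulr0.
Qed.

End Fooling.

Theorem theorem3 (R : realType) (D1 : Type) (F1 : rkhs R D1)
  (e1 e2 : D1 -> R)
  (g11 := fun t => e1 t ^+ 2)
  (g22 := fun t => e2 t ^+ 2)
  (g12 := fun t => Num.sqrt 2 * (e1 t * e2 t))
  (g11_in : in_rkhs F1 g11)
  (g22_in : in_rkhs F1 g22)
  (g12_in : in_rkhs F1 g12)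
  (g11_norm : inner F1 (elt F1 g11) (elt F1 g11) = 1)
  (g22_norm : inner F1 (elt F1 g22) (elt F1 g22) = 1)
  (g12_norm : inner F1 (elt F1 g12) (elt F1 g12) = 1)
  (g11_g22 : inner F1 (elt F1 g11) (elt F1 g22) = 0)
  (g11_g12 : inner F1 (elt F1 g11) (elt F1 g12) = 0)
  (g22_g12 : inner F1 (elt F1 g22) (elt F1 g12) = 0)
  (S1 : {scalar F1})
  (S1_continuous : continuous S1)
  (S1_g11 : S1 (elt F1 g11) = Num.sqrt 2 / 2)
  (S1_g22 : S1 (elt F1 g22) = Num.sqrt 2 / 2)
  (S1_e1e2 : S1 (elt F1 (fun t => e1 t * e2 t)) = 0)
  (Fd : forall d : nat, rkhs R ('I_d -> D1))
  (Fd_tensor : forall d : nat, is_tensor_power F1 (Fd d))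
  (Sd := fun d : nat => tensor_functional S1 (Fd := Fd d)) :
  [/\ forall d n : nat,
        ((1 - n%:R * 2 ^- d)%:E <= minimal_error (Sd d) n ^+ 2)%E,
      forall (eps : R) (d : nat), 0 <= eps ->
        ((2 ^+ d * (1 - eps ^+ 2))%:E <= information_complexity (Sd d) eps)%E &
      curse_of_dimensionality
        (fun eps d => information_complexity (Sd d) eps)].
Proof.
have sqrt2_neq0 : Num.sqrt 2 != 0 :> R by rewrite gt_eqF ?sqrtr_gt0.
have sqrt2_sqr : Num.sqrt 2 ^+ 2 = 2 :> R by rewrite sqr_sqrtr.
pose e (b : bool) := if b then e1 else e2.
pose E a b := elt F1 (fun t => e a t * e b t).
(* This exhibits [e1 e2] as an element of [F1], so that [elt] of it is not the default 0. *)
have E12 : rkhs_eval F1 ((Num.sqrt 2)^-1 *: elt F1 g12) = fun t => e1 t * e2 t.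
  apply/funext => t; rewrite kernE innerE -kernE eltP // /g12.
  by rewrite mulKf.
have E_tt : E true true = elt F1 g11 by [].
have E_ff : E false false = elt F1 g22 by [].
have E_tf : E true false = (Num.sqrt 2)^-1 *: elt F1 g12.
  by rewrite /E /e -E12 elt_eval.
have E_ft : E false true = (Num.sqrt 2)^-1 *: elt F1 g12.
  by rewrite -E_tf /E /e; congr elt; apply/funext => t; rewrite mulrC.
have E_eval a b t : rkhs_eval F1 (E a b) t = e a t * e b t.
  rewrite /E eltP //; case: a b => [] [] //.
    by exists (E true false); rewrite E_tf.
  by exists (E false true); rewrite E_ft E12; apply/funext => s; rewrite mulrC.
have E_inner a b c f : inner F1 (E a b) (E c f) = sym_inner R a b c f.
  have half : (Num.sqrt 2)^-1 * ((Num.sqrt 2)^-1 * 1) = 2^-1 :> R.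
    by rewrite mulr1 -invfM -expr2 sqrt2_sqr.
  have g22_g11 : inner F1 (elt F1 g22) (elt F1 g11) = 0 by rewrite innerC.
  have g12_g11 : inner F1 (elt F1 g12) (elt F1 g11) = 0 by rewrite innerC.
  have g12_g22 : inner F1 (elt F1 g12) (elt F1 g22) = 0 by rewrite innerC.
  rewrite /sym_inner; case: a b c f => [] [] [] [];
    rewrite ?E_tt ?E_ff ?E_tf ?E_ft ?innerZl ?innerZr
      ?(g11_norm, g22_norm, g12_norm, g11_g22, g11_g12, g22_g12, g22_g11,
        g12_g11, g12_g22) ?half ?mulr0 /= ?add0r ?addr0 ?mul0r ?mul1r //;
    by field.
have E_h a b :
    inner F1 (E a b) (representer S1) = Num.sqrt 2 / 2 * (a == b)%:R.
  rewrite -representerP //; last by move=> r u w; rewrite linearP.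
  by case: a b => [] []; rewrite ?mulr1 ?mulr0 ?E_tt ?E_ff ?E_ft -?E_tf.
have lower d n :
    ((Num.sqrt (1 - n%:R * 2 ^- d))%:E <= minimal_error (Sd d) n)%E.
  exact: (minimal_error_ge E_eval E_inner E_h (Fd_tensor d)).
have bound (eps : R) (d : nat) : 0 <= eps ->
    ((2 ^+ d * (1 - eps ^+ 2))%:E <= information_complexity (Sd d) eps)%E.
  move=> eps0; apply: le_ereal_inf_tmp => _ [n /= n_eps <-].
  have := le_trans (lower d n) n_eps; rewrite !lee_fin.
  have pow_gt0 : 0 < 2 ^+ d :> R by rewrite exprn_gt0.
  rewrite -ler_sqr ?nnegrE ?sqrtr_ge0 // => le_eps.
  have : 1 - n%:R * 2 ^- d <= eps ^+ 2.
    apply: le_trans le_eps.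
    have [le0|gt0] := boolP (1 - n%:R * 2 ^- d <= 0 :> R).
      by apply: le_trans le0 _; rewrite sqr_ge0.
    by rewrite sqr_sqrtr // ltW // ltNge.
  rewrite -(ler_pM2l pow_gt0) !mulrBr mulr1 mulrCA divff ?gt_eqF // mulr1.
  lra.
split=> // [d n|eps /andP[eps0 eps1]].
  have := lower d n; rewrite expe2.
  (* Squaring the square root recovers its argument only when that is nonnegative; otherwise the
     claim is trivial. *)
  have [le0 _|gt0 le] := boolP (1 - n%:R * 2 ^- d <= 0 :> R).
    by apply: le_trans (sqre_ge0 _); rewrite lee_fin.
  rewrite -[in leLHS](@sqr_sqrtr _ (1 - n%:R * 2 ^- d)); last first.
    by rewrite ltW // ltNge.
  by rewrite expr2 EFinM lee_pmul // lee_fin sqrtr_ge0.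
exists (1 - eps ^+ 2), 2; split=> [||d]; last by rewrite mulrC bound // ltW.
  by rewrite subr_gt0 expr_lt1 // ltW.
by rewrite ltr1n.
Qed.
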